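(* Let $k\ge1$ be an integer, $n=2k$, $\pi=(1,2)(3,4)\cdots(2k-1,2k)\in S_n$ and $\sigma=(1,2)(3,4)\in A_4$. Let $\tau$ be the inner automorphism of $Wr(A_4,n)$ given by conjugation by the element $(\sigma,\sigma,\dots,\sigma)\pi$; it has order 2. Write $\overline{i}=i^\pi$ and let $H=\langle\tau\rangle$. Then the fixed subalgebra $M_H$ of the Matsuo algebra $M=M_\eta(Wr(A_4,n))$ has dimension $12k^2-4k$. Among the $H$-orbit vectors, there are - $4k$ singles $t.(2i-1,2i)$, where $t\in K_4$ and $1\le i\le k$; - $12k(k-1)$ doubles $t.(i,j)+t^{\sigma}.(\overline{i},\overline{j})$, where $t\in A_4$ and $\overline{i}\neq j$; - $4k$ extras $t.(2i-1,2i)+(t^{-1})^{\sigma}.(2i-1,2i)$, where $t\in A_4$ is a 3-cycle and $1\le i\le k$.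
   Context: For a group $T$ all of whose elements have order 1, 2 or 3 and an integer $n\ge 2$, let $T\operatorname{wr}S_n=T^n\rtimes S_n$ be the wreath product, with $S_n$ acting naturally on coordinates; for $t\in T$ let $t_i$ be the image of $t$ in the $i$-th factor of $T^n$. The group $Wr(T,n)$ is the subgroup of $T\operatorname{wr}S_n$ generated by the conjugacy class $D$ (in $T\operatorname{wr}S_n$) of a transposition of $S_n$. One has $D=\{t.(i,j)\mid t\in T, 1\le i<j\le n\}$, where $t.(i,j):=t_it_j^{-1}(i,j)$, with $t.(i,j)=t^{-1}.(j,i)$, and $D$ is a class of 3-transpositions: it is a normal generating set of involutions with $|cd|\le3$ for all $c,d\in D$. Here $T=A_4$, $K_4=\{(),(1,2)(3,4),(1,3)(2,4),(1,4)(2,3)\}$, and $t^\sigma=\sigma^{-1}t\sigma$. Let $\mathbb{F}$ be a field of characteristic not two and $\eta\in\mathbb{F}\setminus\{0,1\}$. The Matsuo algebra $M_\eta(G,D)$ (also written $M_\eta(G)$) of a 3-transposition group $(G,D)$ is the commutative $\mathbb{F}$-algebra with basis $D$ and product $c\cdot c=c$; $c\cdot d=0$ if $|cd|=2$; $c\cdot d=\frac{\eta}{2}(c+d-c^d)$ if $|cd|=3$. Automorphisms of $G$ preserving $D$ act on $M_\eta(G,D)$ by permuting $D$. For a group $H$ of such automorphisms, $M_H=\{u\in M\mid u^h=u\text{ for all }h\in H\}$ is the fixed subalgebra; the orbit vectors $\sum_{c\in O}c$, for $O$ an $H$-orbit on $D$, form a basis of $M_H$. If $H=\langle\tau\rangle$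 with $|\tau|=2$, an orbit vector is a single if it is $a\in D$ with $\{a\}$ an orbit of length 1; a double if it is $a+b$ with $\{a,b\}$ an orbit of length 2 and $a\cdot b=0$; an extra if it is $a+b$ with $\{a,b\}$ an orbit of length 2 and $a\cdot b\neq0$. *)

(* Defs.v *)
From HB Require Import structures.
From mathcomp Require Import all_boot all_order all_fingroup all_algebra.
From mathcomp Require Import all_solvable.
Set Implicit Arguments.
Unset Strict Implicit.
Unset Printing Implicit Defensive.
Import GRing.Theory.

(* Permutations act on the right, as in MathComp: (s * u) x = u (s x).        *)

Section Wreath.
Local Open Scope group_scope.
Variables (T : finGroupType) (n : nat).

Definition wr_base : finGroupType := {dffun forall _ : 'I_n, T}.

(* Chosen so that the image of t_i under s is t_(s i). *)
Definition wr_act_fun (f : wr_base) (s : 'S_n) : wr_base :=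
  [ffun i => f (s^-1 i)].

Lemma wr_act1 : wr_act_fun^~ 1 =1 id.
Proof. by move=> f; apply/ffunP=> i; rewrite ffunE invg1 perm1. Qed.

Lemma wr_actM f : act_morph wr_act_fun f.
Proof. by move=> s u; apply/ffunP=> i; rewrite !ffunE invMg permM. Qed.

Canonical wr_action := TotalAction wr_act1 wr_actM.

Lemma wr_is_groupAction : is_groupAction setT wr_action.
Proof.
move=> s _; rewrite inE; apply/andP; split; first by apply/subsetP=> x /[1!inE].
by apply/morphicP=> f g _ _; apply/ffunP=> i; rewrite !actpermE !ffunE.
Qed.

Canonical wr_groupAction := GroupAction wr_is_groupAction.

Definition wreath : finGroupType := sdprod_groupType wr_groupAction.

Definition wr_perm (s : 'S_n) : wreath := sdpair2 wr_groupAction s.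

(* (t_0, ..., t_(n-1)), and t placed in the i-th factor *)
Definition wr_vec (f : 'I_n -> T) : wreath :=
  sdpair1 wr_groupAction [ffun i => f i].
Definition wr_coord (i : 'I_n) (t : T) : wreath :=
  sdpair1 wr_groupAction (@dfung1 'I_n (fun=> T) i t).

(* t.(i,j) *)
Definition wr_tr (t : T) (i j : 'I_n) : wreath :=
  wr_coord i t * (wr_coord j t)^-1 * wr_perm (tperm i j).

(* The conjugacy class of a transposition of S_n; all transpositions being    *)
(* conjugate, the union of their classes is a single class (wr_transE).       *)
Definition wr_trans : {set wreath} :=
  class_support [set wr_perm (tperm p.1 p.2) | p : 'I_n * 'I_n & p.1 != p.2]
                [set: wreath].

Definition Wr : {group wreath} := <<wr_trans>>%G.

Lemma wr_transE (i j : 'I_n) :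
  i != j -> wr_trans = wr_perm (tperm i j) ^: [set: wreath].
Proof.
move=> nij; rewrite /wr_trans class_supportEl; apply/eqP.
rewrite eqEsubset; apply/andP; split; last first.
  by apply: (bigcup_sup (wr_perm (tperm i j))); apply/imsetP; exists (i, j);
    rewrite ?inE.
apply/bigcupsP=> x /imsetP[[i' j'] /[1!inE] /= nij' ->{x}].
suff [s si sj] : exists2 s : 'S_n, s i = i' & s j = j'.
  rewrite -si -sj -tpermJ /wr_perm morphJ ?inE //.
  by rewrite classGidl ?inE.
have nu : tperm i i' j != i'.
  by rewrite (can2_eq (tpermK i i') (tpermK i i')) tpermR eq_sym.
exists (tperm i i' * tperm (tperm i i' j) j'); rewrite permM ?tpermL //.
by rewrite (tpermD nu) // eq_sym.
Qed.

End Wreath.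

Section Matsuo.
Local Open Scope ring_scope.
Variables (F : fieldType) (gT : finGroupType) (D : {set gT}).

Definition matsuo : vectType F := {ffun {c : gT | c \in D} -> F^o}.

(* The basis vector c for c in D (and 0 for c outside D). *)
Definition mbasis (c : gT) : matsuo := [ffun d => (val d == c)%:R].

(* In a 3-transposition group, distinct c, d in D have |cd| = 2 or |cd| = 3. *)
Definition mprod_basis (eta : F) (c d : gT) : matsuo :=
  if c == d then mbasis c
  else if #[c * d]%g == 3%N then
    (eta / 2) *: (mbasis c + mbasis d - mbasis (c ^ d)%g)
  else 0.

Definition mprod (eta : F) (u v : matsuo) : matsuo :=
  \sum_c \sum_d (u c * v d) *: mprod_basis eta (val c) (val d).

Lemma mprod_basisE (eta : F) (c d : gT) : c \in D -> d \in D ->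
  mprod eta (mbasis c) (mbasis d) = mprod_basis eta c d.
Proof.
move=> Dc Dd; pose c' : {x | x \in D} := Sub c Dc.
pose d' : {x | x \in D} := Sub d Dd.
rewrite /mprod (bigD1 c') //= (bigD1 d') //= !ffunE /= !eqxx mul1r scale1r.
rewrite !big1 ?addr0 // => x nx; last first.
  by rewrite !ffunE -[d in _ == d]/(val d') val_eqE (negPf nx) mulr0 scale0r.
rewrite big1 // => y _.
by rewrite !ffunE -[c]/(val c') val_eqE (negPf nx) mul0r scale0r.
Qed.

(* u^h, for an automorphism h preserving D *)
Definition mact (h : {perm gT}) (u : matsuo) : matsuo :=
  \sum_c u c *: mbasis (h (val c)).

Lemma mact_linear h : linear (mact h).
Proof.
move=> a u v; rewrite /mact scaler_sumr -big_split /=; apply: eq_bigr => c _.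
by rewrite !ffunE scalerDl scalerA.
Qed.

HB.instance Definition _ h :=
  GRing.isLinear.Build F matsuo matsuo *:%R (mact h) (mact_linear h).

Definition mfix (H : {group {perm gT}}) : {vspace matsuo} :=
  (\bigcap_(h in H) fixedSpace (linfun (mact h)))%VS.

Lemma mfixP (H : {group {perm gT}}) u :
  reflect (forall h, h \in H -> mact h u = u) (u \in mfix H).
Proof.
rewrite /mfix memvE; apply: (iffP subv_bigcapP) => fixu h Hh.
  by have:= fixu h Hh; rewrite -memvE => /fixedSpaceP; rewrite lfunE.
by rewrite -memvE; apply/fixedSpaceP; rewrite lfunE /= fixu.
Qed.

Definition orbits_on (H : {group {perm gT}}) : {set {set gT}} :=
  orbit 'P H @: D.

Definition orbit_vectors (H : {group {perm gT}}) : seq matsuo :=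
  undup [seq \sum_(c in X) mbasis c | X : {set gT} <- enum (orbits_on H)].

Definition is_single (H : {group {perm gT}}) (v : matsuo) : bool :=
  [exists a in D, ([set a] \in orbits_on H) && (v == mbasis a)].

Definition is_double (eta : F) (H : {group {perm gT}}) (v : matsuo) : bool :=
  [exists a in D, exists b in D,
    [&& a != b, [set a; b] \in orbits_on H,
        mprod eta (mbasis a) (mbasis b) == 0 & v == mbasis a + mbasis b]].

Definition is_extra (eta : F) (H : {group {perm gT}}) (v : matsuo) : bool :=
  [exists a in D, exists b in D,
    [&& a != b, [set a; b] \in orbits_on H,
        mprod eta (mbasis a) (mbasis b) != 0 & v == mbasis a + mbasis b]].

End Matsuo.

Section PermTools.
Local Open Scope group_scope.

(* A permutation with exactly one nontrivial cycle, of length 3. *)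
Definition is_3cycle (U : finType) (s : {perm U}) : bool :=
  [exists x, (#|porbit s x| == 3) && perm_on (porbit s x) s].

(* The points 1, 2, 3, 4 are numbered 0, 1, 2, 3. *)
Definition A4 : finGroupType := subg_of 'Alt_('I_4).

Definition p4 (i : nat) : 'I_4 := inord i.

Definition sigma4 : {perm 'I_4} := tperm (p4 0) (p4 1) * tperm (p4 2) (p4 3).

Definition K4 : {set {perm 'I_4}} :=
  [set 1; sigma4; tperm (p4 0) (p4 2) * tperm (p4 1) (p4 3);
          tperm (p4 0) (p4 3) * tperm (p4 1) (p4 2)].

Lemma sigma4_Alt : sigma4 \in 'Alt_('I_4).
Proof. by rewrite Alt_even odd_permM !odd_tperm -!val_eqE /= !inordK. Qed.

Definition sigma : A4 := Subg sigma4_Alt.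

Variable k : nat.

Fact odd_point_subproof (i : 'I_k) : 2 * i < 2 * k.
Proof. by rewrite ltn_mul2l /=. Qed.

Fact even_point_subproof (i : 'I_k) : (2 * i).+1 < 2 * k.
Proof. by rewrite !mul2n ltn_Sdouble. Qed.

(* The points 2i-1 and 2i (1 <= i <= k), numbered from 0. *)
Definition odd_point (i : 'I_k) : 'I_(2 * k) := Ordinal (odd_point_subproof i).
Definition even_point (i : 'I_k) : 'I_(2 * k) := Ordinal (even_point_subproof i).

Definition pi_perm : 'S_(2 * k) :=
  \prod_(i < k) tperm (odd_point i) (even_point i).

Definition tau_elt : wreath A4 (2 * k) :=
  wr_vec (fun=> sigma) * wr_perm A4 pi_perm.

Definition tau : {perm wreath A4 (2 * k)} := conj_aut (Wr A4 (2 * k)) tau_elt.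

End PermTools.

(* Main.v *)
Require Import Defs.
From mathcomp Require Import all_boot all_order all_fingroup all_algebra.
From mathcomp Require Import all_solvable zify.
Set Implicit Arguments.
Unset Strict Implicit.
Unset Printing Implicit Defensive.
Import GRing.Theory.

(** Conjugation by $(\sigma,\dots,\sigma)\pi$ sends $t.(i,j)$ to
$t^\sigma.(\bar i,\bar j)$ ([wr_trJ_tau]), because conjugating $t.(i,j)$ by a
vector $f$ gives $(f_i^{-1}tf_j).(i,j)$ ([wr_trJ_vec]) and conjugating it by a
permutation moves the two indices. Everything is read off this formula.

Suppose $\bar i\neq j$. As $\pi$ has no fixed point, $i,j,\bar i,\bar j$ are
pairwise distinct, so $t.(i,j)$ and its image are distinct and commute; their
product in the algebra is 0 and the orbit is a double ([tau_outer]).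

If $\bar i=j$, the element may be written $t.(2m-1,2m)$ and its image is
$(t^{-1})^\sigma.(2m-1,2m)$. The quotient $t\,((t^{-1})^\sigma)^{-1}$ of the
two labels is $(t\sigma)^2$. In $A_4$ an element squares to 1 exactly when it
lies in $K_4$, every other element is a 3-cycle, and $K_4$ is stable under
multiplication by $\sigma$. So for $t\in K_4$ the element is fixed, a single,
while for a 3-cycle $t$ the quotient has order 3; the product of $t.(i,j)$ and
$u.(i,j)$ has the order of $tu^{-1}$ ([order3_wr_tr]). Then the product in the
algebra is nonzero, because 2 and $\eta$ are ([mprod_eq0]), and the orbit is
an extra.

The counts follow. There are $12\binom{2k}{2}$ elements in $D$
([card_wr_trans]), of which $4k$ are fixed and $8k$ lie in extras; the remaining
$24k(k-1)$ lie in doubles. For any group acting on $D$ the orbit vectors form a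
basis of the fixed subalgebra ([dim_mfix]), so its dimension is the number of
orbits, which the Cauchy-Frobenius formula gives as half of
$|D|+4k$ ([card_orbits_involution]). *)

(** * Transpositions in a wreath product *)

Section WreathTranspositions.
Local Open Scope group_scope.
Variables (T : finGroupType) (n : nat).
Implicit Types (f g : 'I_n -> T) (s u : 'S_n) (t v : T) (i j l : 'I_n).

Lemma eq_wr_vec f g : f =1 g -> wr_vec f = wr_vec g.
Proof.
by move=> eq_fg; congr (sdpair1 _ _); apply/ffunP=> i; rewrite !ffunE eq_fg.
Qed.

Lemma wr_vecM f g : wr_vec f * wr_vec g = wr_vec (fun i => f i * g i).
Proof.
rewrite /wr_vec -morphM ?inE //; congr (sdpair1 _ _).
by apply/ffunP=> i; rewrite !ffunE.
Qed.

Lemma wr_vec1 : wr_vec (fun=> 1 : T) = 1 :> wreath T n.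
Proof.
rewrite -[RHS](morph1 (sdpair1_morphism (wr_groupAction T n))).
by congr (sdpair1 _ _); apply/ffunP=> i; rewrite !ffunE.
Qed.

Lemma wr_vecV f : (wr_vec f)^-1 = wr_vec (fun i => (f i)^-1).
Proof.
apply/eqP; rewrite eq_invg_mul wr_vecM -wr_vec1.
by apply/eqP/eq_wr_vec=> i; rewrite mulgV.
Qed.

Lemma wr_permM s u : wr_perm T (s * u) = wr_perm T s * wr_perm T u.
Proof. by rewrite /wr_perm morphM ?inE. Qed.

Lemma wr_permJ s u : wr_perm T s ^ wr_perm T u = wr_perm T (s ^ u).
Proof. by rewrite /wr_perm morphJ ?inE. Qed.

Lemma wr_permV s : wr_perm T s^-1 = (wr_perm T s)^-1.
Proof. by rewrite /wr_perm morphV ?inE. Qed.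

Lemma wr_vecJ f s : wr_vec f ^ wr_perm T s = wr_vec (fun i => f (s^-1 i)).
Proof.
rewrite /wr_vec /wr_perm -sdpair_act ?inE //=; congr (sdpair1 _ _).
by apply/ffunP=> i; rewrite !ffunE.
Qed.

Lemma wr_vec_prod I (r : seq I) (f : I -> 'I_n -> T) :
  \prod_(l <- r) wr_vec (f l) = wr_vec (fun i => \prod_(l <- r) f l i).
Proof.
elim: r => [|l r IHr].
  by rewrite big_nil -wr_vec1; apply: eq_wr_vec => i; rewrite big_nil.
by rewrite big_cons IHr wr_vecM; apply: eq_wr_vec => i; rewrite big_cons.
Qed.

Lemma wr_coordE i t : wr_coord i t = wr_vec (fun l => if l == i then t else 1).
Proof.
congr (sdpair1 _ _); apply/ffunP=> l; rewrite ffunE.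
by case: eqVneq => [->|ne]; rewrite ?dfung1_id ?dfung1_dflt // eq_sym.
Qed.

(** Together with [wr_normal_inj], this reduces identities in the wreath product
to coordinatewise ones in $T$ and in $S_n$. *)
Lemma wr_normalP (x : wreath T n) : exists f s, x = wr_vec f * wr_perm T s.
Proof.
exists (fun i => x.2 (x.1 i)), x.1; rewrite [LHS]sdpairE -/(wr_perm T x.1).
have ->: sdpair1 (wr_groupAction T n) x.2 = wr_vec x.2.
  by congr (sdpair1 _ _); apply/ffunP=> i; rewrite ffunE.
rewrite conjgCV -wr_permV wr_vecJ; congr (_ * _); apply: eq_wr_vec => i.
by rewrite invgK.
Qed.

Lemma wr_normal_inj f g s u :
  wr_vec f * wr_perm T s = wr_vec g * wr_perm T u -> f =1 g /\ s = u.
Proof.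
set toW := wr_groupAction T n.
move=> eq_fg; have := sdprod_sdpair toW; case/sdprodP=> _ _ _ tiW.
have /eqP: (wr_vec g)^-1 * wr_vec f == 1.
  rewrite -in_set1 -[[set 1]]tiW inE; apply/andP; split.
    by rewrite groupM ?groupV ?mem_morphim ?inE.
  suff ->: (wr_vec g)^-1 * wr_vec f = wr_perm T u * (wr_perm T s)^-1.
    by rewrite groupM ?groupV ?mem_morphim ?inE.
  by apply/(mulIg (wr_perm T s)); rewrite mulgKV -mulgA eq_fg mulKg.
move/eqP; rewrite -eq_invg_mul invgK => /eqP eq_gf.
split; last first.
  by move: eq_fg; rewrite eq_gf => /mulgI/(injmP (injm_sdpair2 _))->; rewrite ?inE.
move=> i; have /(injmP (injm_sdpair1 _)): wr_vec g = wr_vec f by [].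
by rewrite !inE => /(_ isT isT)/ffunP/(_ i); rewrite !ffunE.
Qed.

Lemma wr_trE t i j : i != j ->
  wr_tr t i j
  = wr_vec (fun l => if l == i then t else if l == j then t^-1 else 1)
    * wr_perm T (tperm i j).
Proof.
move=> nij; rewrite /wr_tr !wr_coordE wr_vecV wr_vecM; congr (_ * _).
apply: eq_wr_vec => l; case: (eqVneq l i) => [->|_].
  by rewrite (negPf nij) invg1 mulg1.
by case: eqP => _; rewrite ?mul1g ?invg1.
Qed.

Lemma wr_tr1 i j : wr_tr 1 i j = wr_perm T (tperm i j).
Proof.
rewrite /wr_tr !wr_coordE wr_vecV wr_vecM -[RHS]mul1g -wr_vec1; congr (_ * _).
by apply: eq_wr_vec => l; rewrite !if_same mulgV.
Qed.

Lemma wr_trC t i j : i != j -> wr_tr t i j = wr_tr t^-1 j i.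
Proof.
move=> nij; rewrite (wr_trE t) // wr_trE 1?eq_sym // tpermC invgK; congr (_ * _).
apply: eq_wr_vec => l; case: (eqVneq l i) => // ->.
by rewrite (negPf nij).
Qed.

Lemma wr_trJ_perm t i j s :
  i != j -> wr_tr t i j ^ wr_perm T s = wr_tr t (s i) (s j).
Proof.
move=> nij; rewrite !wr_trE ?(inj_eq perm_inj) // conjMg wr_permJ tpermJ.
rewrite wr_vecJ; congr (_ * _); apply: eq_wr_vec => l.
by rewrite !(can2_eq (permKV s) (permK s)).
Qed.

(** Moving $f$ across the transposition swaps its coordinates $i$ and $j$, and all
other coordinates cancel. At $t=1$ this describes the whole class of
$(i,j)$ under the base group. *)
Lemma wr_trJ_vec t i j f :
  i != j -> wr_tr t i j ^ wr_vec f = wr_tr ((f i)^-1 * t * f j) i j.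
Proof.
move=> nij; rewrite !wr_trE // conjMg conjgE wr_vecV !wr_vecM.
rewrite [_ ^ wr_vec f]conjgE [in X in _ * X]wr_vecV -mulgA.
rewrite [wr_perm _ _ * wr_vec f]conjgCV -wr_permV tpermV wr_vecJ tpermV.
rewrite !mulgA !wr_vecM.
congr (_ * _); apply: eq_wr_vec => l.
case: (eqVneq l i) => [->|nli]; first by rewrite tpermL !mulgA mulgK.
case: (eqVneq l j) => [->|nlj].
  by rewrite tpermR !mulgA mulgK !invMg invgK mulgA.
by rewrite tpermD 1?eq_sym // mul1g mulVg mul1g mulVg.
Qed.

(** $t.(i,j)=t^{-1}.(j,i)$ is the only coincidence among the $t.(i,j)$. *)
Lemma wr_tr_inj t t' i j i' j' : i != j -> i' != j' ->
  wr_tr t i j = wr_tr t' i' j' ->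
  [/\ t = t', i = i' & j = j'] \/ [/\ t = t'^-1, i = j' & j = i'].
Proof.
move=> nij nij'; rewrite !wr_trE // => /wr_normal_inj[eq_t eq_s].
have /permP/(_ i') := eq_s; rewrite tpermL.
case: tpermP => [ei ej|ei ej|_ _ ij']; last by rewrite ij' eqxx in nij'.
  by left; move: (eq_t i); rewrite ei ej !eqxx.
right; move: (eq_t i); rewrite ei -ej !eqxx (negPf nij).
by split.
Qed.

Lemma wr_transP x :
  reflect (exists t i j, i != j /\ x = wr_tr t i j) (x \in wr_trans T n).
Proof.
apply: (iffP imset2P) => [[_ w /imsetP[[i j] /[1!inE] nij ->] _ ->] | ].
  have [f [s ->]] := wr_normalP w; rewrite /= -wr_tr1 conjgM wr_trJ_vec //.
  rewrite wr_trJ_perm //; do 3!eexists; split; last by [].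
  by rewrite (inj_eq perm_inj).
case=> t [i [j [nij ->]]].
(* The conjugate of (i,j) by f has label f_i^-1 f_j, so f = t_j yields t. *)
exists (wr_tr 1 i j) (wr_vec (fun l => if l == j then t else 1)).
- by rewrite wr_tr1; apply/imsetP; exists (i, j); rewrite ?inE.
- by rewrite inE.
by rewrite wr_trJ_vec // eqxx (negPf nij) invg1 !mul1g.
Qed.

Lemma mem_wr_trans t i j : i != j -> wr_tr t i j \in wr_trans T n.
Proof. by move=> nij; apply/wr_transP; exists t, i, j. Qed.

Lemma wr_trans_invol x : x \in wr_trans T n -> x * x = 1.
Proof.
case/imset2P=> _ w /imsetP[p _ ->] _ ->.
by rewrite -conjMg -wr_permM tperm2 /wr_perm morph1 conj1g.
Qed.

Lemma wr_vecX f m : wr_vec f ^+ m = wr_vec (fun i => f i ^+ m).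
Proof.
elim: m => [|m IHm]; first by rewrite expg0 -wr_vec1; apply: eq_wr_vec.
by rewrite expgS IHm wr_vecM; apply: eq_wr_vec => i; rewrite expgS.
Qed.

Lemma wr_tr_mulE t v i j : i != j ->
  wr_tr t i j * wr_tr v i j
  = wr_vec (fun l => if l == i then t * v^-1
                     else if l == j then t^-1 * v else 1).
Proof.
move=> nij; rewrite !wr_trE // mulgA -(mulgA (wr_vec _)).
rewrite [wr_perm T _ * wr_vec _]conjgCV -wr_permV tpermV wr_vecJ -!mulgA.
rewrite -wr_permM tperm2 [wr_perm T 1]morph1 mulg1.
rewrite wr_vecM tpermV; apply: eq_wr_vec => l.
case: (eqVneq l i) => [->|nli]; first by rewrite tpermL eqxx eq_sym (negPf nij).
case: (eqVneq l j) => [->|nlj]; first by rewrite tpermR eqxx.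
by rewrite tpermD ?[_ == l]eq_sym // (negPf nli) (negPf nlj) mulg1.
Qed.

(** The product is the vector with entries $tv^{-1}$ at $i$ and $t^{-1}v$ at $j$, and
the second is a conjugate of the inverse of the first. *)
Lemma order3_wr_tr t v i j : i != j -> t != v -> (t * v^-1) ^+ 3 = 1 ->
  #[wr_tr t i j * wr_tr v i j] = 3.
Proof.
move=> nij ntu tu3; apply: nt_prime_order => //.
  rewrite wr_tr_mulE // wr_vecX -wr_vec1; apply: eq_wr_vec => l.
  case: ifP => // _; case: ifP => _; rewrite ?expg1n //.
  have ->: t^-1 * v = (t * v^-1)^-1 ^ t by rewrite conjgE invMg invgK mulgKV.
  by rewrite -conjXg expgVn tu3 invg1 conj1g.
apply: contra ntu; rewrite -[wr_tr v i j]invgK -eq_mulgV1.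
have ->: (wr_tr v i j)^-1 = wr_tr v i j.
  by apply/eqP; rewrite eq_invg_mul (wr_trans_invol (mem_wr_trans v nij)).
by move/eqP/(wr_tr_inj nij nij) => [[->]|[_ ij]] //; rewrite ij eqxx in nij.
Qed.

(** With disjoint supports, conjugation by one factor changes neither the label nor
the indices of the other. *)
Lemma wr_tr_commute t v i j i' j' : i != j -> i' != j' ->
  i != i' -> i != j' -> j != i' -> j != j' ->
  commute (wr_tr t i j) (wr_tr v i' j').
Proof.
move=> nij nij' nii' nij'' nji' njj'; apply/commgP/conjg_fixP.
rewrite [wr_tr v _ _]wr_trE // conjgM wr_trJ_vec // wr_trJ_perm //.
rewrite (negPf nii') (negPf nij'') (negPf nji') (negPf njj') invg1 mul1g mulg1.
by rewrite !tpermD 1?eq_sym.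
Qed.

Lemma card_ltn_pairs : #|[set p : 'I_n * 'I_n | (p.1 < p.2)%N]| = 'C(n, 2).
Proof.
rewrite -sum1_card (eq_bigl (fun p : 'I_n * 'I_n => (p.1 < p.2)%N)); last first.
  by move=> p; rewrite inE.
rewrite -(pair_big_dep xpredT (fun i j : 'I_n => (i < j)%N) (fun _ _ => 1%N)) /=.
rewrite (exchange_big_dep xpredT) //= -bin2_sum big_mkord.
apply: eq_bigr => j _.
by rewrite (big_ord_narrow (ltnW (ltn_ord j))) sum1_card card_ord.
Qed.

(** Ordering the indices makes the parametrization by labels and pairs
injective. *)
Lemma card_wr_trans : #|wr_trans T n| = (#|T| * 'C(n, 2))%N.
Proof.
pose A := setX [set: T] [set p : 'I_n * 'I_n | (p.1 < p.2)%N].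
pose h p := wr_tr p.1 p.2.1 p.2.2 : wreath T n.
have ltn_neq (i j : 'I_n) : (i < j)%N -> i != j.
  by move=> lt_ij; apply: contraTneq lt_ij => ->; rewrite ltnn.
have ->: wr_trans T n = h @: A.
  apply/setP=> x; apply/wr_transP/imsetP => [[t [i [j [nij ->]]]] | ].
    case: (ltngtP i j) => [lt_ij|lt_ji|/val_inj eq_ij].
    - by exists (t, (i, j)); rewrite ?inE.
    - by exists (t^-1, (j, i)); rewrite ?inE // /h -wr_trC.
    - by rewrite eq_ij eqxx in nij.
  case=> -[t [i j]]; rewrite !inE /= => lt_ij ->.
  by exists t, i, j; rewrite ltn_neq.
rewrite card_in_imset ?cardsX ?cardsT ?card_ltn_pairs //.
move=> [t [i j]] [t' [i' j']]; rewrite !inE /h /= => lt_ij lt_ij'.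
move/(wr_tr_inj (ltn_neq _ _ lt_ij) (ltn_neq _ _ lt_ij')) => [[-> -> ->] //|].
by case=> _ eq_i eq_j; rewrite eq_i eq_j ltnNge ltnW in lt_ij.
Qed.

End WreathTranspositions.

(** * The Klein four-group and the 3-cycles of $A_4$ *)

Section AlternatingFour.
Local Open Scope group_scope.

Section FourPoints.
Variable (U : finType).
Hypothesis cardU : #|U| = 4.
Implicit Types (s u : {perm U}) (x y z : U).

Lemma fourth_point (A : {set U}) y z :
  #|A| = 3 -> y \notin A -> z \notin A -> y = z.
Proof.
move=> A3 Ay Az; have /eqP/cards1P[w defA]: #|~: A| = 1%N.
  by rewrite cardsCs setCK A3 cardU.
by move: Ay Az; rewrite -!in_setC defA !inE => /eqP-> /eqP->.
Qed.

(** Such an involution pairs $x$ with $s(x)$ and hence must pair the other two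
points together. *)
Lemma fixfree_involution_eq s u x :
    s * s = 1 -> u * u = 1 -> (forall y, s y != y) -> (forall y, u y != y) ->
  s x = u x -> s = u.
Proof.
move=> ss uu fs fu eq_x.
have sK : involutive s by move=> y; rewrite -permM ss perm1.
have uK : involutive u by move=> y; rewrite -permM uu perm1.
apply/permP=> z; have [->//|nzx] := eqVneq z x.
have [->|nzs] := eqVneq z (s x); first by rewrite sK eq_x uK.
apply: (@fourth_point [set x; s x; z]).
- rewrite -setUA cardsU1 cards2 !inE !(eq_sym _ z) (eq_sym x).
  by rewrite (negPf (fs x)) (negPf nzx) (negPf nzs).
- rewrite !inE (can2_eq sK sK) (negPf nzs) (inj_eq perm_inj) (negPf nzx) /=.
  exact: fs.
- rewrite !inE eq_x (can2_eq uK uK) -eq_x (negPf nzs).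
  by rewrite eq_x (inj_eq perm_inj) (negPf nzx) /=; apply: fu.
Qed.

(** An involution on four points with a fixed point is a transposition or 1, and
transpositions are odd. *)
Lemma even_involution_fixfree s x :
  ~~ odd_perm s -> s * s = 1 -> s x = x -> s = 1.
Proof.
move=> even_s ss sx; apply/permP=> y; rewrite perm1; apply/eqP.
apply: contraNT even_s => nsy.
have sK : involutive s by move=> z; rewrite -permM ss perm1.
suff ->: s = tperm y (s y) by rewrite odd_tperm eq_sym.
have nyx : y != x by apply: contraNneq nsy => ->; rewrite sx.
apply/permP=> z; case: tpermP => [-> //|->|/eqP nzy /eqP nzsy]; first by rewrite sK.
have [->//|nzx] := eqVneq z x.
apply: (@fourth_point [set x; y; s y]).
- rewrite -setUA cardsU1 cards2 !inE (eq_sym y) nsy (eq_sym x) (negPf nyx) (eq_sym x).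
  by rewrite -{1}sx (inj_eq perm_inj) (negPf nyx).
- rewrite !inE -{1}sx !(inj_eq perm_inj) (can2_eq sK sK).
  by rewrite (negPf nzx) (negPf nzy) (negPf nzsy).
- by rewrite !inE (negPf nzx) (negPf nzy) (negPf nzsy).
Qed.

Lemma is_3cycle_cube s : is_3cycle s -> s ^+ 3 = 1.
Proof.
case/existsP=> x /andP[/eqP x3 s_on]; apply/permP=> y; rewrite perm1 permX.
have [xy|nxy] := boolP (y \in porbit s x); last by rewrite /= !(out_perm s_on).
by rewrite -x3; move: xy; rewrite -eq_porbit_mem => /eqP<-; apply: iter_porbit.
Qed.

Lemma involution_not_3cycle s : s * s = 1 -> ~~ is_3cycle s.
Proof.
move=> ss; apply/existsP=> -[x /andP[/eqP x3 _]].
have := uniq_traject_porbit s x; rewrite x3 /=.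
by rewrite -permM ss perm1 !inE eqxx orbT.
Qed.

(** On four points an even permutation has an even number of cycles, so it cannot be
a 4-cycle. If it has no 3-cycle either, all its cycles have length at most 2. *)
Lemma even_not_3cycle s : ~~ odd_perm s -> ~~ is_3cycle s -> s * s = 1.
Proof.
move=> even_s no3; apply/permP=> x; rewrite permM perm1.
have lt0 := card_porbit_neq0 s x.
have le4 : (#|porbit s x| <= 4)%N by rewrite -cardU max_card.
have n4 : #|porbit s x| != 4.
  apply: contra even_s => /eqP x4.
  have xT : porbit s x = setT.
    by apply/eqP; rewrite eqEcard subsetT cardsT cardU x4.
  have defP : porbits s = [set setT].
    apply/setP=> X; rewrite inE; apply/imsetP/eqP => [[y _ ->] | ->].
      by apply/eqP; rewrite -xT eq_porbit_mem xT inE.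
    by exists x.
  by rewrite /odd_perm cardU defP cards1.
have n3 : #|porbit s x| != 3.
  apply: contra no3 => x3; apply/existsP; exists x; rewrite x3 /=.
  apply/subsetP=> y; apply: contraLR => nxy.
  rewrite inE negbK; apply/eqP/(fourth_point (eqP x3)) => //.
  apply: contra nxy.
  by rewrite -!eq_porbit_mem -(porbit_perm s 1 y) expg1.
have := iter_porbit s x.
case: #|_| lt0 le4 n4 n3 => [|[|[|[|[|m]]]]] //= _ _ _ _ sx; by rewrite !sx.
Qed.

End FourPoints.

Lemma p4E i (lt_i4 : (i < 4)%N) : p4 i = Ordinal lt_i4.
Proof. by apply: val_inj; rewrite /= inordK. Qed.

Lemma K4E s :
  (s \in K4) = [|| s == 1, s == sigma4,
                   s == tperm (p4 0) (p4 2) * tperm (p4 1) (p4 3)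
                 | s == tperm (p4 0) (p4 3) * tperm (p4 1) (p4 2)].
Proof. by rewrite /K4 !inE -!orbA. Qed.

Local Ltac eval_perm4 :=
  rewrite /sigma4 !p4E //; apply/permP=> -[[|[|[|[|?]]]] ?] //;
  rewrite !permM !permE; exact: val_inj.

Lemma K4_fixfree s : s \in K4 -> s != 1 -> forall x, s x != x.
Proof.
rewrite K4E /sigma4 !p4E // => /or4P[] /eqP-> //; rewrite ?eqxx // => _.
all: by move=> [[|[|[|[|x]]]] ltx] //; rewrite !permM !permE.
Qed.

Lemma K4_involution s : s \in K4 -> s * s = 1.
Proof. by rewrite K4E => /or4P[] /eqP->; [rewrite mulg1 | eval_perm4..]. Qed.

Lemma K4_sigmaM s : s \in K4 -> s * sigma4 \in K4.
Proof.
rewrite !K4E => /or4P[] /eqP->; apply/or4P.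
- by apply: Or42; rewrite mul1g.
- by apply/Or41/eqP; apply: K4_involution; rewrite K4E eqxx orbT.
- by apply/Or44/eqP; eval_perm4.
- by apply/Or43/eqP; eval_perm4.
Qed.

Lemma K4_sub_Alt : K4 \subset 'Alt_('I_4).
Proof.
apply/subsetP=> s; rewrite K4E Alt_even => /or4P[] /eqP->; rewrite ?odd_perm1 //.
all: by rewrite odd_permM !odd_tperm !p4E.
Qed.

Lemma K4_transitive x : exists2 s, s \in K4 & s (p4 0) = x.
Proof.
case: x => [[|[|[|[|x]]]] ltx] //.
- by exists 1; [rewrite K4E eqxx | rewrite perm1 p4E //; exact: val_inj].
- exists sigma4; first by rewrite K4E eqxx orbT.
  by rewrite /sigma4 !p4E // permM !permE; exact: val_inj.
- exists (tperm (p4 0) (p4 2) * tperm (p4 1) (p4 3)).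
    by rewrite K4E eqxx !orbT.
  by rewrite !p4E // permM !permE; exact: val_inj.
- exists (tperm (p4 0) (p4 3) * tperm (p4 1) (p4 2)).
    by rewrite K4E eqxx !orbT.
  by rewrite !p4E // permM !permE; exact: val_inj.
Qed.

(** A nontrivial even involution moves every point, so by [fixfree_involution_eq] it
is determined by the image of one point; by transitivity some element of $K_4$
has the same image there. *)
Lemma mem_K4 s : s \in 'Alt_('I_4) -> (s \in K4) = (s * s == 1).
Proof.
rewrite Alt_even => even_s; apply/idP/eqP => [/K4_involution // | ss].
have [->|ns1] := eqVneq s 1; first by rewrite K4E eqxx.
have fs x : s x != x.
  apply: contraNneq ns1 => sx.
  by rewrite (even_involution_fixfree _ even_s ss sx) ?card_ord.
have [u Ku ux] := K4_transitive (s (p4 0)).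
suff ->: s = u by [].
have nu1 : u != 1.
  by apply: contraTneq (fs (p4 0)) => u1; rewrite -ux u1 perm1 eqxx.
apply: (fixfree_involution_eq (x := p4 0) _ ss (K4_involution Ku) fs _ (esym ux)).
  by rewrite card_ord.
exact: K4_fixfree.
Qed.

Lemma is_3cycleE s : s \in 'Alt_('I_4) -> is_3cycle s = (s \notin K4).
Proof.
move=> As; rewrite mem_K4 //; apply/idP/idP; last first.
  apply: contraR => no3; apply/eqP; apply: even_not_3cycle no3.
    by rewrite card_ord.
  by rewrite -Alt_even.
by apply: contraTN => /eqP; apply: involution_not_3cycle.
Qed.

Lemma card_K4 : #|K4| = 4.
Proof.
have im0 : [set s (p4 0) | s : 'S_4 in K4] = setT.
  apply/setP=> x; rewrite inE; have [s Ks <-] := K4_transitive x.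
  exact: imset_f.
apply/eqP; rewrite eqn_leq; apply/andP; split; last first.
  by rewrite -{1}(card_ord 4) -cardsT -im0 leq_imset_card.
have leU (A : {set 'S_4}) s m : (#|A| <= m -> #|A :|: [set s]| <= m.+1)%N.
  by move=> leA; rewrite setUC cardsU1 -(add1n m) leq_add ?leq_b1.
by do 3!apply: (leU); rewrite cards1.
Qed.

Implicit Types t : A4.

Lemma card_A4 : #|A4| = 12.
Proof.
have := @card_Alt 'I_4; rewrite !card_ord => /(_ isT) card_Alt4.
have ->: #|A4| = #|'Alt_('I_4)| by rewrite card_sub.
by apply: double_inj; rewrite -mul2n card_Alt4.
Qed.

Lemma mem_A4_K4 t : (val t \in K4) = (t * t == 1).
Proof. by rewrite mem_K4 ?subgP // -(inj_eq val_inj). Qed.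

Lemma A4_3cycleE t : is_3cycle (val t) = (val t \notin K4).
Proof. by rewrite is_3cycleE ?subgP. Qed.

Lemma card_A4_K4 : #|[set t : A4 | val t \in K4]| = 4.
Proof.
rewrite -[RHS]card_K4 -(card_imset _ val_inj); apply: eq_card => s.
apply/imsetP/idP => [[t /[1!inE] Kt ->] // | Ks].
by exists (Subg (subsetP K4_sub_Alt s Ks)); rewrite 1?inE.
Qed.

Lemma card_A4_3cycle : #|[set t : A4 | is_3cycle (val t)]| = 8.
Proof.
have := cardsC [set t : A4 | val t \in K4].
rewrite card_A4_K4 card_A4 => /(@addnI 4 _ 8) <-.
by apply: eq_card => t; rewrite in_setC [in LHS]inE [in RHS]inE A4_3cycleE.
Qed.

Lemma A4_cube t : val t \notin K4 -> t ^+ 3 = 1.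
Proof.
rewrite -A4_3cycleE => /is_3cycle_cube t3.
by apply: val_inj; rewrite -[RHS]t3 !expgS !expg0.
Qed.

Lemma sigma_sqr : sigma * sigma = 1.
Proof. by apply/eqP; rewrite -mem_A4_K4 K4E eqxx orbT. Qed.

Lemma sigmaV : sigma^-1 = sigma.
Proof. by apply/eqP; rewrite eq_invg_mul sigma_sqr. Qed.

Lemma A4_sigmaM t : (val (t * sigma) \in K4) = (val t \in K4).
Proof.
apply/idP/idP=> [/K4_sigmaM | /K4_sigmaM //].
by rewrite -[_ * sigma4]/(val (t * sigma * sigma)) -mulgA sigma_sqr mulg1.
Qed.

(** Since $\sigma^2=1$, the equation $\sigma t^{-1}\sigma=t$ says that
$(t\sigma)^2=1$, i.e. that $t\sigma$, and hence $t$, lies in $K_4$. *)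
Lemma sigma_invJ t : (t^-1 ^ sigma == t) = (val t \in K4).
Proof.
rewrite -A4_sigmaM mem_A4_K4 -eq_invg_mul invMg -(inj_eq (mulIg sigma)).
by rewrite conjgE sigmaV -!mulgA sigma_sqr mulg1.
Qed.

(** The element is $(t\sigma)^2$, and $t\sigma$ is a 3-cycle. *)
Lemma sigma_invJ_cube t :
  val t \notin K4 -> (t * (t^-1 ^ sigma)^-1) ^+ 3 = 1.
Proof.
rewrite -A4_sigmaM => Kts.
have ->: t * (t^-1 ^ sigma)^-1 = (t * sigma) ^+ 2.
  by rewrite -conjVg invgK conjgE sigmaV expgS expg1 !mulgA.
by rewrite -expgM mulnC expgM A4_cube // expg1n.
Qed.

End AlternatingFour.

(** * Orbit vectors in a Matsuo algebra *)

Lemma order_mulC (gT : finGroupType) (a b : gT) : #[a * b]%g = #[b * a]%g.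
Proof.
have ->: (a * b = (b * a) ^ b)%g by rewrite conjgE -mulgA mulKg.
exact: orderJ.
Qed.

Section OrbitVectors.
Local Open Scope ring_scope.
Variables (F : fieldType) (gT : finGroupType) (D : {set gT}).
Implicit Types (X Y : {set gT}) (h : {perm gT}) (u : matsuo F D).

Definition orbit_sum X : matsuo F D := \sum_(c in X) mbasis F D c.

Lemma orbit_sumE X (d : {c | c \in D}) : orbit_sum X d = (val d \in X)%:R.
Proof.
rewrite sum_ffunE; under eq_bigr do rewrite ffunE.
have [Xd|nXd] := boolP (val d \in X).
  rewrite (bigD1 (val d)) //= eqxx big1 ?addr0 // => c /andP[_ ncd].
  by rewrite eq_sym (negPf ncd).
by rewrite big1 // => c Xc; case: eqP nXd => // ->; rewrite Xc.
Qed.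

Lemma orbit_sum_inj X Y :
  X \subset D -> Y \subset D -> orbit_sum X = orbit_sum Y -> X = Y.
Proof.
move=> sXD sYD eqXY.
have eq_in c : c \in D -> (c \in X) = (c \in Y).
  move=> Dc; have /ffunP/(_ (Sub c Dc)) := eqXY; rewrite !orbit_sumE /=.
  by case: (c \in X); case: (c \in Y) => // /eqP; rewrite ?oner_eq0 // eq_sym oner_eq0.
apply/setP=> c; have [/eq_in //|nDc] := boolP (c \in D).
by rewrite !(contraNF (subsetP _ c) nDc).
Qed.

Lemma orbit_sum1 c : orbit_sum [set c] = mbasis F D c.
Proof. by rewrite /orbit_sum big_set1. Qed.

Lemma orbit_sum2 c d :
  c != d -> orbit_sum [set c; d] = mbasis F D c + mbasis F D d.
Proof. by move=> ncd; rewrite /orbit_sum big_setU1 ?inE //= big_set1. Qed.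

Lemma mactE h u (c d : {c | c \in D}) :
  val d = h (val c) -> Defs.mact h u d = u c.
Proof.
move=> def_d; rewrite /Defs.mact sum_ffunE (bigD1 c) //= !ffunE def_d eqxx.
rewrite [_ *: _]mulr1 big1 ?addr0 // => b nbc.
by rewrite !ffunE def_d (inj_eq perm_inj) val_eqE eq_sym (negPf nbc) scaler0.
Qed.

Lemma mact_fixP h u : {in D, forall c, h c \in D} ->
  (Defs.mact h u = u <-> forall c d : {c | c \in D}, val d = h (val c) -> u d = u c).
Proof.
move=> hD; split=> [fix_u c d dc | fix_u].
  by rewrite -{1}fix_u (mactE _ dc).
apply/ffunP=> d; have: (h^-1)%g (val d) \in D.
  have im_h : h @: D = D.
    apply/eqP; rewrite eqEcard card_imset ?leqnn ?andbT; last exact: perm_inj.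
    by apply/subsetP=> _ /imsetP[c Dc ->]; apply: hD.
  have := valP d; move: (val d) => c; rewrite /= -{1}im_h => /imsetP[b Db ->].
  by rewrite permK.
move=> Dc; pose c : {c | c \in D} := Sub ((h^-1)%g (val d)) Dc.
have def_d : val d = h (val c) by rewrite /= permKV.
by rewrite (mactE _ def_d) (fix_u _ _ def_d).
Qed.

Section Group.
Variable H : {group {perm gT}}.
Hypothesis actsHD : [acts H, on D | 'P].

Lemma orbit_subD X : X \in orbits_on D H -> X \subset D.
Proof.
by case/imsetP=> c Dc ->; rewrite acts_sub_orbit.
Qed.

Lemma perm_closed h : h \in H -> {in D, forall c, h c \in D}.
Proof. by move=> Hh c Dc; have := acts_act actsHD Hh c; rewrite Dc => ->. Qed.

Lemma orbits_eq X Y c : X \in orbits_on D H -> Y \in orbits_on D H ->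
  c \in X -> c \in Y -> X = Y.
Proof.
move=> /imsetP[a Da ->] /imsetP[b Db ->]; rewrite -!orbit_eq_mem.
by move=> /eqP-> /eqP->.
Qed.

(** A vector is fixed exactly when its coordinates are constant on orbits, so the
orbit vectors span; having disjoint supports, they are independent. *)
Lemma dim_mfix : \dim (mfix F D H) = #|orbits_on D H|.
Proof.
pose O := orbits_on D H; pose b := [tuple orbit_sum (enum_val i) | i < #|O|].
have bE (i : 'I_#|O|) : b`_i = orbit_sum (enum_val i).
  by rewrite -tnth_nth tnth_mktuple.
have sumE (k : 'I_#|O| -> F) (d : {c | c \in D}) (i : 'I_#|O|) :
    val d \in enum_val i -> (\sum_j k j *: b`_j) d = k i.
  move=> Oid; rewrite sum_ffunE (bigD1 i) //= big1 => [|j nji].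
    by rewrite ffunE bE orbit_sumE Oid addr0 [_ *: _]mulr1.
  rewrite ffunE bE orbit_sumE; case: (boolP (_ \in _)) => [Ojd|_]; last first.
    by rewrite scaler0.
  case/eqP: nji; apply: enum_val_inj.
  exact: orbits_eq (enum_valP _) (enum_valP _) Ojd Oid.
have orbit_index a : a \in D -> exists i : 'I_#|O|, enum_val i = orbit 'P H a.
  move=> Da; have OX : orbit 'P H a \in O by rewrite imset_f.
  by exists (enum_rank_in OX (orbit 'P H a)); rewrite enum_rankK_in.
have defb : basis_of (mfix F D H) b.
  apply/andP; split; last first.
  apply/freeP=> k k0 i.
  have [a Da defO] := imsetP (enum_valP i).
  have Oia : val (Sub a Da : {c | c \in D}) \in enum_val i.
    by rewrite defO orbit_refl.
  by rewrite -(sumE k _ _ Oia) k0 ffunE.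
apply/eqP/vspaceP=> u; apply/idP/mfixP=> [/coord_span-> h Hh | fix_u].
  apply/mact_fixP=> [|c d def_d]; first exact: perm_closed.
  have [i Oi] := orbit_index _ (valP c).
  rewrite !(sumE _ _ i) ?Oi ?orbit_refl // def_d; exact: mem_orbit.
(* The coefficient of an orbit is the coordinate of u at any of its points; the
   default 0 is never reached, orbits being nonempty. *)
pose k (i : 'I_#|O|) :=
  if [pick c : {c | c \in D} | val c \in enum_val i] is Some c then u c else 0.
suff ->: u = \sum_j k j *: b`_j.
  by apply: memv_suml => j _; apply/memvZ/memv_span/mem_nth; rewrite size_tuple.
apply/ffunP=> d.
have [i Oi] := orbit_index _ (valP d).
rewrite (sumE _ _ i) ?Oi ?orbit_refl // /k Oi.
case: pickP => [c /imsetP[h Hh def_c] | /(_ d)]; last by rewrite orbit_refl.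
have [eq_u _] := mact_fixP u (perm_closed Hh).
by rewrite (eq_u (fix_u h Hh) _ _ def_c).
exact: size_basis defb.
Qed.
(** Distinct orbits have distinct vectors, so selecting orbit vectors by a predicate
amounts to selecting orbits. The set [A] gathers the elements of the selected
orbits. *)
Lemma mem_orbit_vectors (p : pred (matsuo F D)) (A : {set gT}) :
    A \subset D ->
    {in D, forall c, p (orbit_sum (orbit 'P H c)) = (c \in A)} ->
  forall v, v \in [seq w <- orbit_vectors F D H | p w] <->
            exists2 c, c \in A & v = orbit_sum (orbit 'P H c).
Proof.
move=> sAD pA v; rewrite mem_filter mem_undup; split.
  case/andP=> pv /mapP[X /[!mem_enum] /imsetP[c Dc ->] def_v]; exists c => //.
  by rewrite -pA //; rewrite def_v in pv.
case=> c Ac def_v; have Dc := subsetP sAD c Ac.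
rewrite def_v pA // Ac; apply/mapP; exists (orbit 'P H c) => //.
by rewrite mem_enum imset_f.
Qed.

Lemma size_orbit_vectors (p : pred (matsuo F D)) (A : {set gT}) :
    A \subset D ->
    {in D, forall c, p (orbit_sum (orbit 'P H c)) = (c \in A)} ->
  size [seq w <- orbit_vectors F D H | p w] = #|orbit 'P H @: A|.
Proof.
move=> sAD pA; have vP := mem_orbit_vectors sAD pA.
have inj_sum : {in orbit 'P H @: A &, injective orbit_sum}.
  move=> X Y AX AY; apply: orbit_sum_inj; apply: orbit_subD.
    by apply: subsetP AX; apply: imsetS.
  by apply: subsetP AY; apply: imsetS.
rewrite cardE -(size_map orbit_sum); apply/perm_size/uniq_perm.
- by rewrite filter_uniq ?undup_uniq.
- by rewrite map_inj_in_uniq ?enum_uniq // => X Y; rewrite !mem_enum; apply: inj_sum.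
move=> v; apply/idP/mapP=> [/vP[c Ac ->] | [X]].
  by exists (orbit 'P H c); rewrite ?mem_enum ?imset_f.
by rewrite mem_enum => /imsetP[c Ac ->] ->; apply/vP; exists c.
Qed.

End Group.

Section Involution.
Variables (eta : F) (tau : {perm gT}).
Hypothesis char2 : 2%N \notin [pchar F].
Hypothesis eta0 : eta != 0.
Hypothesis involD : {in D, forall c, c * c = 1}%g.
Hypothesis tau2 : #[tau]%g = 2%N.
Hypothesis tauD : {in D, forall c, tau c \in D}.
Let H := <[tau]>%G.

(** If $|ab|=3$, the product has coefficient $\eta/2\neq0$ at $a$: one has $a\neq a^b$,
for otherwise the involutions $a$ and $b$ commute and $(ab)^2=1$. *)
Lemma mprod_eq0 a b : a \in D -> b \in D -> a != b ->
  (mprod eta (mbasis F D a) (mbasis F D b) == 0) = (#[a * b]%g != 3%N).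
Proof.
move=> Da Db nab; rewrite mprod_basisE // /mprod_basis (negPf nab).
have [ab3|_] := eqVneq #[a * b]%g 3%N; last by rewrite eqxx.
have nac : a != (a ^ b)%g.
  apply/eqP=> /esym/conjg_fixP/commgP cab.
  have: ((a * b) ^+ 2 == 1)%g.
    by rewrite expgMn // !expg2 (involD Da) (involD Db) mulg1.
  by rewrite -order_dvdn ab3.
apply/negbTE/eqP=> /ffunP/(_ (Sub a Da))/eqP; rewrite !ffunE /= eqxx.
rewrite (negPf nab) (negPf nac) addr0 subr0 [_ *: _]mulr1.
have n2 : 2 != 0 :> F by move: char2; rewrite inE.
by rewrite mulf_eq0 invr_eq0 (negPf eta0) (negPf n2).
Qed.

Lemma tauK : involutive tau.
Proof. by move=> c; rewrite -permM -expg2 -tau2 expg_order perm1. Qed.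

Lemma orbit_pair c : orbit 'P H c = [set c; tau c].
Proof. by rewrite /orbit /= cycle2g // imsetU1 imset_set1 /= apermE perm1. Qed.

Lemma acts_invariant (A : {set gT}) :
  {in A, forall c, tau c \in A} -> [acts H, on A | 'P].
Proof.
move=> tauA; rewrite cycle_subG !inE /=; apply/subsetP=> c Ac.
by rewrite inE /= apermE tauA.
Qed.

Let actsD := acts_invariant tauD.

Lemma card_fixfree_orbits (A : {set gT}) :
    {in A, forall c, tau c \in A} -> {in A, forall c, tau c != c} ->
  (#|orbit 'P H @: A| * 2)%N = #|A|.
Proof.
move=> tauA ffA; have := orbit_partition (acts_invariant tauA).
move/(card_uniform_partition (n := 2%N))=> -> // _ /imsetP[c Ac ->].
by rewrite orbit_pair cards2 eq_sym ffA.
Qed.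

(** The Cauchy-Frobenius formula for a group with the two elements 1 and [tau]. *)
Lemma card_orbits_involution :
  (#|orbits_on D H| * 2 = #|D| + #|[set c in D | tau c == c]|)%N.
Proof.
have := Frobenius_Cauchy actsD; rewrite -[#|H|]/#[tau]%g tau2 => <-.
rewrite (eq_bigl (mem [set 1%g; tau])) => [|h]; last by rewrite /= cycle2g.
rewrite big_setU1 ?big_set1 ?inE //=; last first.
  by apply/eqP=> tau1; have := tau2; rewrite -tau1 order1.
congr (_ + _)%N; apply: eq_card => c; rewrite !inE; last first.
  by rewrite sub1set !inE.
by rewrite sub1set !inE /= apermE perm1 eqxx andbT.
Qed.

Lemma mem_orbits_on (X : {set gT}) c :
  c \in X -> X \in orbits_on D H -> X = [set c; tau c].
Proof.
move=> Xc /imsetP[a Da defX]; rewrite -orbit_pair defX; apply/esym/eqP.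
by rewrite orbit_eq_mem -defX.
Qed.

Lemma is_singleE c : c \in D ->
  is_single H (orbit_sum (orbit 'P H c)) = (tau c == c).
Proof.
move=> Dc; apply/exists_inP/eqP => [[a Da /andP[Oa]]|fix_c].
  rewrite -orbit_sum1 => /eqP/orbit_sum_inj eq_a.
  have {}eq_a : orbit 'P H c = [set a].
    by apply: eq_a; apply: (orbit_subD actsD) => //; rewrite imset_f.
  have: c \in [set a] by rewrite -eq_a orbit_refl.
  have: tau c \in [set a] by rewrite -eq_a orbit_pair !inE eqxx orbT.
  by rewrite !inE => /eqP-> /eqP->.
have Oc : orbit 'P H c = [set c] by rewrite orbit_pair fix_c setUid.
exists c => //; rewrite Oc orbit_sum1 eqxx andbT -Oc.
exact: imset_f.
Qed.

(** The definitions of doubles and extras quantify over an ordered pair $(a,b)$ that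
enumerates the orbit, in either of its two orders. For a symmetric condition [q]
it suffices to test $(c,c^\tau)$. *)
Lemma is_pairE (q : rel gT) c : {in D &, symmetric q} -> c \in D ->
  [exists a in D, exists b in D,
    [&& a != b, [set a; b] \in orbits_on D H, q a b
      & orbit_sum (orbit 'P H c) == mbasis F D a + mbasis F D b]]
  = (tau c != c) && q c (tau c).
Proof.
move=> qC Dc; apply/exists_inP/andP=> [[a Da /exists_inP[b Db]] | [fc qc]].
  case/and4P=> nab Oab qab /eqP; rewrite -orbit_sum2 // => /orbit_sum_inj eq_ab.
  have {}eq_ab : orbit 'P H c = [set a; b].
    by apply: eq_ab; apply: (orbit_subD actsD) => //; rewrite imset_f.
  have tau_a : tau a = b.
    have: b \in [set a; tau a].
      by rewrite -(mem_orbits_on _ Oab) ?inE ?eqxx ?orbT.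
    by rewrite !inE eq_sym (negPf nab) => /eqP.
  have: c \in [set a; b] by rewrite -eq_ab orbit_refl.
  have tau_b : tau b = a by rewrite -tau_a tauK.
  rewrite !inE => /orP[]/eqP->; first by rewrite tau_a eq_sym nab.
  by rewrite tau_b nab qC.
exists c => //; apply/exists_inP; exists (tau c); first exact: tauD.
rewrite eq_sym fc qc -orbit_pair imset_f //= orbit_pair orbit_sum2 ?eqxx //.
by rewrite eq_sym.
Qed.

Let vanish := [rel a b | mprod eta (mbasis F D a) (mbasis F D b) == 0].

Lemma mprod_vanishC : {in D &, symmetric vanish}.
Proof.
move=> a b Da Db /=; have [-> //|nab] := eqVneq a b.
by rewrite !mprod_eq0 ?[b == a]eq_sym // order_mulC.
Qed.

Lemma is_doubleE c : c \in D ->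
  is_double eta H (orbit_sum (orbit 'P H c))
  = (tau c != c) && (#[c * tau c]%g != 3%N).
Proof.
move=> Dc; rewrite [LHS](is_pairE mprod_vanishC Dc) /=.
by apply: andb_id2l => fc; rewrite mprod_eq0 ?tauD // eq_sym.
Qed.

Lemma is_extraE c : c \in D ->
  is_extra eta H (orbit_sum (orbit 'P H c))
  = (tau c != c) && (#[c * tau c]%g == 3%N).
Proof.
move=> Dc; rewrite [LHS](@is_pairE (fun a b => ~~ vanish a b)) //=.
  by apply: andb_id2l => fc; rewrite mprod_eq0 ?tauD ?negbK // eq_sym.
by move=> a b Da Db /=; congr (~~ _); apply: mprod_vanishC.
Qed.

Lemma singles_involution (A := [set c in D | tau c == c]) :
  let S := [seq v <- orbit_vectors F D H | is_single H v] in
  size S = #|A| /\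
  forall v, v \in S <-> exists2 c, c \in A & v = mbasis F D c.
Proof.
have sAD : A \subset D by apply/subsetP=> c /setIdP[].
have pA c : c \in D -> is_single H (orbit_sum (orbit 'P H c)) = (c \in A).
  by move=> Dc; rewrite is_singleE // inE Dc.
have orbA c : c \in A -> orbit 'P H c = [set c].
  by case/setIdP=> _ /eqP fc; rewrite orbit_pair fc setUid.
split=> [|v]; last first.
  apply: (iff_trans (mem_orbit_vectors sAD pA v)).
  by split=> -[c Ac ->]; exists c; rewrite // orbA // orbit_sum1.
rewrite (size_orbit_vectors actsD sAD pA) (eq_in_imset orbA).
by rewrite card_imset //; apply: set1_inj.
Qed.

Lemma pairs_involution (p : pred (matsuo F D)) (A : {set gT}) :
    A \subset D -> {in A, forall c, tau c \in A} -> {in A, forall c, tau c != c} ->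
    {in D, forall c, p (orbit_sum (orbit 'P H c)) = (c \in A)} ->
  let S := [seq v <- orbit_vectors F D H | p v] in
  (size S * 2 = #|A|)%N /\
  forall v, v \in S <-> exists2 c, c \in A & v = mbasis F D c + mbasis F D (tau c).
Proof.
move=> sAD tauA ffA pA; split=> [|v].
  by rewrite (size_orbit_vectors actsD sAD pA) card_fixfree_orbits.
apply: (iff_trans (mem_orbit_vectors sAD pA v)).
by split=> -[c Ac ->]; exists c => //; rewrite orbit_pair orbit_sum2 // eq_sym ffA.
Qed.

Lemma doubles_involution
    (A := [set c in D | (tau c != c) && (#[c * tau c]%g != 3%N)]) :
  let S := [seq v <- orbit_vectors F D H | is_double eta H v] in
  (size S * 2 = #|A|)%N /\
  forall v, v \in S <-> exists2 c, c \in A & v = mbasis F D c + mbasis F D (tau c).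
Proof.
apply: pairs_involution => [|c|c|c Dc]; last by rewrite is_doubleE // inE Dc.
- by apply/subsetP=> c /setIdP[].
- case/setIdP=> Dc /andP[fc oc]; rewrite inE tauD //= tauK eq_sym fc.
  by rewrite order_mulC.
- by case/setIdP=> _ /andP[].
Qed.

Lemma extras_involution
    (A := [set c in D | (tau c != c) && (#[c * tau c]%g == 3%N)]) :
  let S := [seq v <- orbit_vectors F D H | is_extra eta H v] in
  (size S * 2 = #|A|)%N /\
  forall v, v \in S <-> exists2 c, c \in A & v = mbasis F D c + mbasis F D (tau c).
Proof.
apply: pairs_involution => [|c|c|c Dc]; last by rewrite is_extraE // inE Dc.
- by apply/subsetP=> c /setIdP[].
- case/setIdP=> Dc /andP[fc oc]; rewrite inE tauD //= tauK eq_sym fc.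
  by rewrite order_mulC.
- by case/setIdP=> _ /andP[].
Qed.

Lemma card_D_split :
  #|D| = (#|[set c in D | tau c == c]|
          + #|[set c in D | (tau c != c) && (#[c * tau c]%g != 3%N)]|
          + #|[set c in D | (tau c != c) && (#[c * tau c]%g == 3%N)]|)%N.
Proof.
rewrite -(cardsID [set c | tau c == c] D) -addnA; congr (_ + _)%N.
  by apply: eq_card => c; rewrite !inE.
rewrite -(cardsID [set c | #[c * tau c]%g == 3%N] (D :\: _)) addnC.
by congr (_ + _)%N; apply: eq_card => c; rewrite !inE;
  case: (c \in D); case: (tau c == c); case: (#[_]%g == _).
Qed.

End Involution.
End OrbitVectors.

(** * The automorphism $\tau$ *)

Section Tau.
Local Open Scope group_scope.
Variable k : nat.
Local Notation n := (2 * k)%N.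
Implicit Types (t : A4) (m : 'I_k) (i j : 'I_n).

Lemma odd_neq_even m1 m2 : odd_point m1 != even_point m2.
Proof.
apply/eqP=> /(congr1 val)/(congr1 odd) /=.
by rewrite !mul2n !odd_double.
Qed.

Lemma odd_point_inj : injective (@odd_point k).
Proof. by move=> m1 m2 /(congr1 val)/eqP; rewrite /= eqn_mul2l => /eqP/val_inj. Qed.

Lemma even_point_inj : injective (@even_point k).
Proof.
by move=> m1 m2 /(congr1 val)/eqP; rewrite /= eqSS eqn_mul2l => /eqP/val_inj.
Qed.

Lemma pointP i : exists m, i = odd_point m \/ i = even_point m.
Proof.
have lt_i : (i./2 < k)%N.
  by rewrite ltn_half_double -mul2n.
exists (Ordinal lt_i); have := odd_double_half i; rewrite -mul2n.
case: (odd i) => def_i; [right | left]; apply: val_inj; exact: esym def_i.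
Qed.

(** The 2-cycles of $\pi$ are disjoint. Partial products are considered so that the
value can be found by induction on the list of factors. *)
Lemma prod_tperm_points (r : seq 'I_k) m : uniq r ->
  let p := \prod_(l <- r) tperm (odd_point l) (even_point l) in
  p (odd_point m) = (if m \in r then even_point m else odd_point m)
  /\ p (even_point m) = (if m \in r then odd_point m else even_point m).
Proof.
elim: r => [|l r IHr] /=; first by rewrite big_nil !perm1.
case/andP=> nrl /IHr[odd_m even_m]; rewrite big_cons !permM inE.
have [eq_ml|nml] := eqVneq m l.
  rewrite eq_ml (negPf nrl) in odd_m even_m *.
  by rewrite tpermL tpermR odd_m even_m.
have nlm : l != m by rewrite eq_sym.
have neo m1 m2 : even_point m1 != odd_point m2 by rewrite eq_sym odd_neq_even.
by rewrite !tpermD ?(inj_eq odd_point_inj) ?(inj_eq even_point_inj) ?odd_neq_even.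
Qed.

Lemma pi_odd m : pi_perm k (odd_point m) = even_point m.
Proof.
have [+ _] := prod_tperm_points m (index_enum_uniq 'I_k).
by rewrite mem_index_enum.
Qed.

Lemma pi_even m : pi_perm k (even_point m) = odd_point m.
Proof.
have [_] := prod_tperm_points m (index_enum_uniq 'I_k).
by rewrite mem_index_enum.
Qed.

Lemma piK : involutive (pi_perm k).
Proof. by move=> i; have [m [->|->]] := pointP i; rewrite ?(pi_odd, pi_even). Qed.

Lemma pi_neq i : pi_perm k i != i.
Proof.
have [m [->|->]] := pointP i; rewrite ?(pi_odd, pi_even) ?odd_neq_even //.
by rewrite eq_sym odd_neq_even.
Qed.

Lemma wr_trJ_tau t i j : i != j ->
  wr_tr t i j ^ tau_elt k = wr_tr (t ^ sigma) (pi_perm k i) (pi_perm k j).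
Proof.
by move=> nij; rewrite /tau_elt conjgM wr_trJ_vec // wr_trJ_perm // conjgE mulgA.
Qed.

(** The element is $\prod_m\sigma.(2m-1,2m)$ up to commuting the factors: since
$\sigma=\sigma^{-1}$, the product of $\sigma.(i,j)$ and $(i,j)$ is the vector
with entries $\sigma$ at both $i$ and $j$. *)
Lemma tau_elt_Wr : tau_elt k \in Wr A4 n.
Proof.
have W_tr t i j : i != j -> wr_tr t i j \in Wr A4 n.
  by move=> nij; apply/mem_gen/mem_wr_trans.
pose f m l :=
  if l == odd_point m then sigma else if l == even_point m then sigma else 1.
have W_f m : wr_vec (f m) \in Wr A4 n.
  have nm := odd_neq_even m m; have := groupM (W_tr sigma _ _ nm) (W_tr 1 _ _ nm).
  by rewrite wr_tr_mulE // invg1 !mulg1 sigmaV.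
rewrite /tau_elt; apply: groupM; last first.
  rewrite /pi_perm (big_morph _ (@wr_permM A4 n) (morph1 _)).
  by apply: group_prod => m _; rewrite -wr_tr1 W_tr ?odd_neq_even.
suff ->: wr_vec (fun=> sigma) = \prod_m wr_vec (f m) by apply: group_prod.
rewrite wr_vec_prod; apply: eq_wr_vec => l.
rewrite (eq_bigr (fun m => if (l == odd_point m) || (l == even_point m)
                           then sigma else 1)) => [|m _]; last first.
  by rewrite /f; case: eqP.
rewrite -big_mkcond /=.
have [m0 def_l] := pointP l; rewrite (big_pred1 m0) // => m.
case: def_l => ->; rewrite ?(inj_eq odd_point_inj) ?(inj_eq even_point_inj).
  by rewrite (negPf (odd_neq_even _ _)) orbF eq_sym.
by rewrite eq_sym (negPf (odd_neq_even _ _)) eq_sym.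
Qed.

Lemma tau_elt_sqr : tau_elt k * tau_elt k = 1.
Proof.
have cvp : commute (wr_vec (fun=> sigma)) (wr_perm A4 (pi_perm k)).
  by apply/commgP/conjg_fixP; rewrite wr_vecJ.
rewrite -expg2 /tau_elt expgMn // !expg2 wr_vecM -wr_permM.
have ->: pi_perm k * pi_perm k = 1.
  by apply/permP=> i; rewrite permM piK perm1.
rewrite [wr_perm _ 1]morph1 mulg1 -wr_vec1; apply: eq_wr_vec => _.
exact: sigma_sqr.
Qed.

Lemma tauE c : c \in wr_trans A4 n -> tau k c = c ^ tau_elt k.
Proof.
move=> Dc; apply: norm_conj_autE; last exact: mem_gen.
by rewrite (subsetP (normG _)) ?tau_elt_Wr.
Qed.

Lemma tau_tr t i j : i != j ->
  tau k (wr_tr t i j) = wr_tr (t ^ sigma) (pi_perm k i) (pi_perm k j).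
Proof. by move=> nij; rewrite tauE ?mem_wr_trans // wr_trJ_tau. Qed.

Lemma tau_closed : {in wr_trans A4 n, forall c, tau k c \in wr_trans A4 n}.
Proof.
move=> _ /wr_transP[t [i [j [nij ->]]]].
by rewrite tau_tr // mem_wr_trans ?(inj_eq perm_inj).
Qed.

(** The elements of $D$ lying over the 2-cycles of $\pi$: $\tau$ changes only their
labels, and the singles and extras are made of them. *)
Definition inner_tr t m := wr_tr t (odd_point m) (even_point m).

Lemma tau_inner t m : tau k (inner_tr t m) = inner_tr (t^-1 ^ sigma) m.
Proof.
rewrite tau_tr ?odd_neq_even // pi_odd pi_even wr_trC 1?eq_sym ?odd_neq_even //.
by rewrite conjVg.
Qed.

Lemma inner_tr_inj t u m l : inner_tr t m = inner_tr u l -> t = u /\ m = l.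
Proof.
case/(wr_tr_inj (odd_neq_even _ _) (odd_neq_even _ _)).
  by case=> -> /odd_point_inj ->.
by case=> _ /eqP; rewrite (negPf (odd_neq_even _ _)).
Qed.

Lemma card_inner (X : {set A4}) :
  #|[set inner_tr p.1 p.2 | p in setX X [set: 'I_k]]| = (#|X| * k)%N.
Proof.
rewrite card_imset ?cardsX ?cardsT ?card_ord // => -[t m] [u l] /=.
by case/inner_tr_inj=> -> ->.
Qed.

Lemma in_setXT (X : {set A4}) t m : ((t, m) \in setX X [set: 'I_k]) = (t \in X).
Proof. by rewrite in_setX in_setT andbT. Qed.

Lemma tau_inner_fix t m : (tau k (inner_tr t m) == inner_tr t m) = (val t \in K4).
Proof.
rewrite tau_inner -sigma_invJ; apply/eqP/eqP=> [/inner_tr_inj[] // | -> //].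
Qed.

Lemma order_inner t m : val t \notin K4 ->
  #[inner_tr t m * tau k (inner_tr t m)] = 3.
Proof.
move=> nKt; rewrite tau_inner; apply: order3_wr_tr (odd_neq_even _ _) _ _.
  by rewrite eq_sym sigma_invJ.
exact: sigma_invJ_cube.
Qed.

(** The indices $i,j,\bar i,\bar j$ are pairwise distinct, so the element commutes with
its image. *)
Lemma tau_outer t i j (c := wr_tr t i j) : i != j -> pi_perm k i != j ->
  tau k c != c /\ #[c * tau k c] != 3.
Proof.
move=> nij npij.
have npji : pi_perm k j != i by rewrite (can2_eq piK piK) eq_sym.
have nc : tau k c != c.
  have nij' : pi_perm k i != pi_perm k j by rewrite (inj_eq perm_inj).
  rewrite tau_tr //; apply/eqP=> /(wr_tr_inj nij' nij)[].
    by case=> _ /eqP; rewrite (negPf (pi_neq _)).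
  by case=> _ /eqP; rewrite (negPf npij).
split=> //.
have Dc : c \in wr_trans A4 n by apply: mem_wr_trans.
have cc : commute c (tau k c).
  rewrite tau_tr //; apply: wr_tr_commute; rewrite ?(inj_eq perm_inj) //.
  - by rewrite eq_sym pi_neq.
  - by rewrite eq_sym.
  - by rewrite eq_sym.
  - by rewrite eq_sym pi_neq.
apply/eqP=> o3; have: (c * tau k c) ^+ 2 == 1.
  rewrite expgMn // !expg2 (wr_trans_invol Dc).
  by rewrite (wr_trans_invol (tau_closed Dc)) mulg1.
by rewrite -order_dvdn o3.
Qed.

Lemma wr_trans_cases c : c \in wr_trans A4 n ->
  (exists t m, c = inner_tr t m) \/
  (exists t i j, [/\ i != j, pi_perm k i != j & c = wr_tr t i j]).
Proof.
case/wr_transP=> t [i [j [nij ->]]].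
have [def_j|npij] := eqVneq (pi_perm k i) j; last by right; exists t, i, j.
left; rewrite -def_j; have [m [->|->]] := pointP i.
  by exists t, m; rewrite pi_odd.
exists t^-1, m; rewrite pi_even /inner_tr [RHS]wr_trC ?invgK ?odd_neq_even //.
Qed.

(** For $k\geq1$ a 3-cycle label over the first 2-cycle of $\pi$ is moved. *)
Lemma order_tau : (0 < k)%N -> #[tau k] = 2.
Proof.
move=> k_gt0; apply: nt_prime_order => //.
  rewrite expg2 -conj_aut_morphM ?(subsetP (normG _)) ?tau_elt_Wr //.
  by rewrite tau_elt_sqr [LHS](morph1 (conj_aut_morphism _)).
have [t Kt] : exists t : A4, val t \notin K4.
  have /card_gt0P[t] : (0 < #|[set t : A4 | is_3cycle (val t)]|)%N.
    by rewrite card_A4_3cycle.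
  by rewrite inE A4_3cycleE; exists t.
apply: contra Kt => /eqP tau1.
by rewrite -(tau_inner_fix t (Ordinal k_gt0)) tau1 perm1.
Qed.

Local Notation D := (wr_trans A4 n).

Lemma mem_inner t m : inner_tr t m \in D.
Proof. exact/mem_wr_trans/odd_neq_even. Qed.

Lemma tau_fixedE : [set c in D | tau k c == c]
  = [set inner_tr p.1 p.2 | p in setX [set t : A4 | val t \in K4] [set: 'I_k]].
Proof.
apply/setP=> c; apply/setIdP/imsetP=> [[/wr_trans_cases[[t [m ->]]|]] | ].
- by rewrite tau_inner_fix => Kt; exists (t, m); rewrite ?in_setXT 1?inE.
- case=> t [i [j [nij npij ->]]].
  by have [/negPf->] := tau_outer t nij npij.
case=> -[t m]; rewrite in_setXT inE => Kt ->.
by rewrite mem_inner tau_inner_fix.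
Qed.

Lemma tau_extraE : [set c in D | (tau k c != c) && (#[c * tau k c] == 3)]
  = [set inner_tr p.1 p.2
      | p in setX [set t : A4 | is_3cycle (val t)] [set: 'I_k]].
Proof.
apply/setP=> c; apply/setIdP/imsetP=> [[/wr_trans_cases[[t [m ->]]|]] | ].
- rewrite tau_inner_fix -A4_3cycleE => /andP[Kt _].
  by exists (t, m); rewrite ?in_setXT 1?inE.
- case=> t [i [j [nij npij ->]]].
  by have [_ /negPf->] := tau_outer t nij npij; rewrite andbF.
case=> -[t m]; rewrite in_setXT inE A4_3cycleE => Kt ->.
by rewrite mem_inner tau_inner_fix Kt order_inner.
Qed.

Lemma tau_doubleP c :
  reflect (exists t i j, [/\ i != j, pi_perm k i != j & c = wr_tr t i j])
          (c \in [set c in D | (tau k c != c) && (#[c * tau k c] != 3)]).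
Proof.
apply: (iffP setIdP) => [[/wr_trans_cases[[t [m ->]]|//]] | ].
  by rewrite tau_inner_fix => /andP[Kt]; rewrite order_inner.
case=> t [i [j [nij npij ->]]]; have [nc no] := tau_outer t nij npij.
by rewrite mem_wr_trans ?nc.
Qed.

Lemma card_D : #|D| = (12 * k * (2 * k).-1)%N.
Proof.
rewrite card_wr_trans card_A4 bin2 -(mulnA 2) (mul2n (k * _)) doubleK.
by rewrite mulnA.
Qed.

End Tau.

Lemma orbit_count k x :
  (x * 2 = 12 * k * (2 * k).-1 + 4 * k -> x = 12 * k ^ 2 - 4 * k)%N.
Proof.
case: k => [|k]; first by lia.
rewrite mulnS /= => def_x; nia.
Qed.

Lemma double_count k x y :
  (12 * k * (2 * k).-1 = 4 * k + y + 8 * k -> x * 2 = y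
   -> x = 12 * k * (k - 1))%N.
Proof.
case: k => [|k]; first by lia.
rewrite mulnS /= subn1 /= => def_y def_x; nia.
Qed.

Lemma extra_count k x : (x * 2 = 8 * k -> x = 4 * k)%N.
Proof. by lia. Qed.

Local Open Scope ring_scope.

Theorem proposition3p11 (F : fieldType) (eta : F) (k : nat) :
  2%N \notin [pchar F] -> eta != 0 -> eta != 1 -> (1 <= k)%N ->
  let n := (2 * k)%N in
  let G := Wr A4 n in
  let D := wr_trans A4 n in
  let M := matsuo F D in
  let e := fun (t : A4) (i j : 'I_n) => mbasis F D (wr_tr t i j) : M in
  let bar := fun i : 'I_n => pi_perm k i in
  let H := <[tau k]>%G in
  let singles := [seq v <- orbit_vectors F D H | is_single H v] in
  let doubles := [seq v <- orbit_vectors F D H | is_double eta H v] in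
  let extras := [seq v <- orbit_vectors F D H | is_extra eta H v] in
  [/\ tau_elt k \in G,
      #[tau k]%g = 2%N
    & \dim (mfix F D H) = (12 * k ^ 2 - 4 * k)%N] /\
  [/\ size singles = (4 * k)%N /\
      (forall v : M, v \in singles <->
        exists (t : A4) (i : 'I_k),
          val t \in K4 /\ v = e t (odd_point i) (even_point i)),
      size doubles = (12 * k * (k - 1))%N /\
      (forall v : M, v \in doubles <->
        exists (t : A4) (i j : 'I_n),
          [/\ i != j, bar i != j
            & v = e t i j + e (t ^ sigma)%g (bar i) (bar j)])
    & size extras = (4 * k)%N /\
      (forall v : M, v \in extras <->
        exists (t : A4) (i : 'I_k),
          is_3cycle (val t) /\
          v = e t (odd_point i) (even_point i)
              + e (t^-1 ^ sigma)%g (odd_point i) (even_point i))].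
Proof.
move=> char2 eta0 _ k_gt0 n G D M e bar H singles doubles extras.
have tau2 := order_tau k_gt0; have tauD := @tau_closed k.
have invD := @wr_trans_invol A4 n.
have cardFix : #|[set c in D | tau k c == c]| = (4 * k)%N.
  by rewrite tau_fixedE card_inner card_A4_K4.
have cardExt :
  #|[set c in D | (tau k c != c) && (#[c * tau k c]%g == 3%N)]| = (8 * k)%N.
  by rewrite tau_extraE card_inner card_A4_3cycle.
have [szS memS] := singles_involution F tau2 tauD.
have [szD memD] := doubles_involution char2 eta0 invD tau2 tauD.
have [szE memE] := extras_involution char2 eta0 invD tau2 tauD.
have split_D := card_D_split D (tau k); rewrite cardFix cardExt card_D in split_D.
have orbs := card_orbits_involution tau2 tauD; rewrite cardFix card_D in orbs.
split; split.
- exact: tau_elt_Wr.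
- exact: tau2.
- by rewrite dim_mfix ?acts_invariant //; apply: orbit_count orbs.
- split=> [|v]; first by rewrite szS.
  apply: (iff_trans (memS v)); rewrite tau_fixedE; split.
    case=> _ /imsetP[[t m] /setXP[/[1!inE] /= Kt _] ->] ->.
    by exists t, m.
  case=> t [m [Kt ->]]; exists (inner_tr t m) => //.
  by apply/imsetP; exists (t, m); rewrite ?in_setXT 1?inE.
- split=> [|v]; first exact: double_count split_D szD.
  apply: (iff_trans (memD v)); split.
    case=> c /tau_doubleP[t [i [j [nij npij ->]]]] ->.
    by exists t, i, j; rewrite tau_tr.
  case=> t [i [j [nij npij ->]]]; exists (wr_tr t i j); last by rewrite tau_tr.
  by apply/tau_doubleP; exists t, i, j.
- split=> [|v]; first exact: extra_count (etrans szE cardExt).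
  apply: (iff_trans (memE v)); rewrite tau_extraE; split.
    case=> _ /imsetP[[t m] /setXP[/[1!inE] /= Kt _] ->] ->.
    by exists t, m; rewrite tau_inner.
  case=> t [m [Kt ->]]; exists (inner_tr t m); last by rewrite tau_inner.
  by apply/imsetP; exists (t, m); rewrite ?in_setXT 1?inE.
Qed.
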